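(* For any prime $p\equiv 1\pmod 4$ with $p\equiv \pm 2\pmod 5$, we have $$\left(\frac{D_p(1,-1)}{p}\right)=1.$$
   Context: For an odd prime $p$, $\left(\frac{\cdot}{p}\right)$ denotes the Legendre symbol (equal to $0$ on multiples of $p$). For $b,c\in\mathbb{Z}$, $D_p(b,c)$ denotes the integer determinant of the $(p-1)\times(p-1)$ matrix with $(i,j)$ entry $(i^2+bij+cj^2)^{p-2}$: $$D_p(b,c)=\left|(i^2+bij+cj^2)^{p-2}\right|_{1\le i,j\le p-1}.$$ *)

(* Defs.v *)
From HB Require Import structures.
From mathcomp Require Import all_boot all_order all_algebra.
Set Implicit Arguments.
Unset Strict Implicit.
Unset Printing Implicit Defensive.
Import Order.TTheory GRing.Theory Num.Theory.
Local Open Scope ring_scope.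

(* Meaningful as the Legendre symbol when [p] is an odd prime. *)
Definition legendre (a : int) (p : nat) : int :=
  if (p %| a)%Z then 0
  else if [exists x : 'I_p, ((x : nat)%:Z ^+ 2 == a %[mod p])%Z] then 1
  else -1.

(* Ordinals start at 0, so the row and column numbers 1 <= i, j <= p - 1 are
   the successors of the elements of ['I_p.-1]. *)
Definition Dmx (p : nat) (b c : int) : 'M[int]_p.-1 :=
  \matrix_(i < p.-1, j < p.-1)
    (i.+1%:Z ^+ 2 + b * i.+1%:Z * j.+1%:Z + c * j.+1%:Z ^+ 2) ^+ (p - 2).

Definition D (p : nat) (b c : int) : int := \det (Dmx p b c).

(* Main.v *)
Require Import Defs.
From HB Require Import structures.
From mathcomp Require Import all_boot all_order all_algebra.
From mathcomp Require Import all_fingroup cyclic finfield ring zify.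
Set Implicit Arguments.
Unset Strict Implicit.
Unset Printing Implicit Defensive.
Import Order.TTheory GRing.Theory Num.Theory.
Local Open Scope ring_scope.

(** Modulo [p] the exponent [p - 2] inverts, and [5], the discriminant of
    [t^2 - t - 1], is not a square. Since the form is homogeneous, the matrix
    acts on the characters [j |-> j^k], so up to a square factor its determinant
    is the product over [k] modulo [p - 1] of
    [mu_k = sum_{t <> 0} t^k / (1 + t - t^2)].
    Apart from one step of the cycle these satisfy the Fibonacci recurrence,
    and [5 mu_k] is the Lucas number [L_k] for [1 <= k <= p]. The invariant
    [mu_{k+1}^2 - mu_{k+1} mu_k - mu_k^2 = +-1/5] shows that no [mu_k] vanishes.
    The substitution [t |-> -1/t] pairs [mu_k] with [mu_{p+1-k} = +-mu_k]; as [-1]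
    is a square, only the unpaired factors [mu_1] and [mu_{(p+1)/2}] matter, and
    their product is [-2 i / 25 = ((1 - i) / 5)^2] with [i^2 = -1]. *)

(** * Power sums over the nonzero elements and the sums [mu] *)

Lemma sum_expr_nonzero (F : finFieldType) (k : nat) :
  (0 < k < #|F|.-1)%N -> \sum_(t : F | t != 0) t ^+ k = 0.
Proof.
case/andP=> k_gt0 k_lt; set S := \sum_(_ | _) _.
(* [X^k - 1] has at most [k] roots, fewer than there are nonzero elements; scaling [t] by [c]
   multiplies the sum by [c ^+ k]. *)
have [c c_neq0 ck_neq1] : exists2 c : F, c != 0 & c ^+ k != 1.
  apply/exists_inP; apply: contraT => /exists_inPn roots.
  have /max_unity_roots/(_ (enum_uniq _)) : all k.-unity_root (enum [pred c : F | c != 0]).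
    apply/allP => c; rewrite mem_enum => c_neq0; apply/unity_rootP/eqP/negPn.
    exact: roots.
  by rewrite -cardE (cardC1 (0 : F)) => /(_ k_gt0); rewrite leqNgt k_lt.
have cS : c ^+ k * S = S.
  rewrite mulr_sumr [RHS](reindex_inj (mulfI c_neq0)).
  by apply: eq_big => [t|t _]; rewrite ?mulf_eq0 ?negb_or ?c_neq0 ?exprMn.
apply/eqP; have /eqP : (c ^+ k - 1) * S = 0 by rewrite mulrBl cS mul1r subrr.
by rewrite mulf_eq0 subr_eq0 (negPf ck_neq1).
Qed.

Definition mu (F : finFieldType) (k : nat) : F :=
  \sum_(t : F | t != 0) t ^+ k / (1 + t - t ^+ 2).

Lemma den_neq0 (F : fieldType) (t : F) :
  (forall x : F, x ^+ 2 != 5) -> 1 + t - t ^+ 2 != 0.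
Proof.
move=> nsq5; apply: contra (nsq5 (2 * t - 1)) => /eqP den0; apply/eqP.
have -> : (2 * t - 1) ^+ 2 = 5 - 4 * (1 + t - t ^+ 2) by ring.
by rewrite den0; ring.
Qed.

Lemma two_neq0 (F : fieldType) : (forall x : F, x ^+ 2 != 5) -> (2 : F) != 0.
Proof.
move=> nsq5; apply: contra (nsq5 1) => /eqP two0; apply/eqP.
have -> : (5 : F) = 1 + 2 * 2 by ring.
by rewrite two0; ring.
Qed.

Lemma five_neq0 (F : fieldType) : (forall x : F, x ^+ 2 != 5) -> (5 : F) != 0.
Proof. by move=> nsq5; have := nsq5 0; rewrite expr0n eq_sym. Qed.

Lemma sum_nonzero_inv (F : finFieldType) (f : F -> F) :
  \sum_(t | t != 0) f (- t^-1) = \sum_(t | t != 0) f t.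
Proof.
rewrite [RHS](reindex_inj (h := fun t : F => - t^-1)); last by move=> x y /oppr_inj/invr_inj.
by apply: eq_bigl => t; rewrite oppr_eq0 invr_eq0.
Qed.

Lemma expf_card_pred (F : finFieldType) (t : F) : t != 0 -> t ^+ #|F|.-1 = 1.
Proof.
move=> t_neq0; apply: (mulfI t_neq0).
by rewrite -exprS prednK ?expf_card ?mulr1 // (ltnW (finNzRing_gt1 F)).
Qed.

(** Under [t |-> -1/t] the denominator becomes [-(1 + t - t^2) / t^2], and [t^(2 - l) = t^k] because
    [t^(k + l) = t^2]. *)
Lemma mu_sym (F : finFieldType) (k l : nat) :
  (forall x : F, x ^+ 2 != 5) -> (k + l = #|F|.+1)%N ->
  mu F l = (-1) ^+ l.+1 * mu F k.
Proof.
move=> nsq5 kl; rewrite /mu -sum_nonzero_inv mulr_sumr; apply: eq_bigr => t t_neq0.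
have tk : t ^+ k = t ^+ 2 / t ^+ l.
  apply: (mulIf (expf_neq0 l t_neq0)); rewrite -exprD kl exprS expf_card.
  by field; rewrite expf_neq0.
have dt := den_neq0 t nsq5.
have e : 1 - t^-1 - (- t^-1) ^+ 2 = - (1 + t - t ^+ 2) / t ^+ 2 by field.
rewrite tk e (exprNn t^-1) exprVn (exprS (-1)); field.
by rewrite oppr_eq0 dt t_neq0 expf_neq0.
Qed.

Lemma natr_card (F : finNzRingType) : #|F|%:R = 0 :> F.
Proof.
have : \sum_(t : F) t = \sum_t t + #|F|%:R.
  by rewrite {1}(reindex_inj (addIr 1)) big_split sumr_const.
by rewrite -{1}[X in X = _]addr0 => /addrI.
Qed.

Lemma mu_card_pred (F : finFieldType) : mu F #|F|.-1 = mu F 0.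
Proof. by apply: eq_bigr => t t_neq0; rewrite expf_card_pred. Qed.

Lemma mu_rec (F : finFieldType) (k : nat) :
  (forall x : F, x ^+ 2 != 5) ->
  mu F k.+2 = mu F k.+1 + mu F k - \sum_(t : F | t != 0) t ^+ k.
Proof.
move=> nsq5; rewrite /mu -big_split -sumrB; apply: eq_bigr => t _ /=.
by rewrite !exprS; field; exact: den_neq0.
Qed.

(** Under [t |-> 1 - t] the factor [2t - 1] changes sign and the denominator is invariant, so the
    sum of [f] over all of [F] vanishes; its term at 0 is [-1]. *)
Lemma mu1_mu0 (F : finFieldType) :
  (forall x : F, x ^+ 2 != 5) -> 2 * mu F 1 = mu F 0 + 1.
Proof.
move=> nsq5; pose f (t : F) := (2 * t - 1) / (1 + t - t ^+ 2).
have sum_f : \sum_t f t = 0.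
  have : 2 * \sum_t f t = 0.
    rewrite mulr_natl mulr2n [X in X + _](reindex_inj (h := fun t : F => 1 - t)); last first.
      by move=> x y /addrI/oppr_inj.
    rewrite -big_split big1 // => t _; rewrite /f /=.
    have -> : 1 + (1 - t) - (1 - t) ^+ 2 = 1 + t - t ^+ 2 by ring.
    by field; exact: den_neq0.
  by move/eqP; rewrite mulf_eq0 (negPf (two_neq0 nsq5)) => /eqP.
have : 2 * mu F 1 - mu F 0 = \sum_(t | t != 0) f t.
  rewrite /mu mulr_sumr -sumrB; apply: eq_bigr => t _.
  by rewrite /f expr0 expr1; field; exact: den_neq0.
move: sum_f; rewrite (bigD1 (0 : F)) //= => h1 h2.
have f0 : f 0 = -1 by rewrite /f expr0n mulr0 sub0r addr0 subr0 divr1.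
move/eqP: h1; rewrite -h2 f0 addrC subr_eq0 subr_eq => /eqP ->; exact: addrC.
Qed.

(** Three linear relations fix [mu_0], [mu_1], [mu_2]: [mu1_mu0], the exceptional recurrence at
    [k = 0], where the power sum is [-1], and [mu_2 = -mu_0] by symmetry. *)
Lemma mu_1_2 (F : finFieldType) : (forall x : F, x ^+ 2 != 5) ->
  mu F 1 = 5^-1 /\ mu F 2 = 3 / 5.
Proof.
move=> nsq5; have n5 := five_neq0 nsq5; have F_gt1 := finNzRing_gt1 F.
have s0 : \sum_(t : F | t != 0) t ^+ 0 = -1.
  have -> : \sum_(t : F | t != 0) t ^+ 0 = \sum_(t in predC1 (0 : F)) 1 by exact: eq_bigl.
  by rewrite sumr_const cardC1 -subn1 natrB ?natr_card ?sub0r // ltnW.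
have r := mu_rec 0 nsq5; have m := mu1_mu0 nsq5.
have s : mu F 2 = - mu F 0.
  rewrite -mu_card_pred (mu_sym (k := #|F|.-1)) ?expr1 // ?mulN1r //; first by ring.
  by rewrite addn2 prednK // ltnW.
rewrite s s0 in r *.
have e : mu F 0 = 2 * mu F 1 - 1 by rewrite m; ring.
have e1 : 5 * mu F 1 = 1.
  move/eqP: r; rewrite e -subr_eq0 => /eqP r.
  transitivity (1 - (- (2 * mu F 1 - 1) - (mu F 1 + (2 * mu F 1 - 1) - -1))); last by rewrite r; ring.
  by ring.
have e2 : mu F 1 = 5^-1 by apply: (mulfI n5); rewrite e1 mulfV.
by split=> //; rewrite e e2; field.
Qed.

Lemma mu_rec0 (F : finFieldType) (k : nat) :
  (forall x : F, x ^+ 2 != 5) -> (0 < k < #|F|.-1)%N ->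
  mu F k.+2 = mu F k.+1 + mu F k.
Proof. by move=> nsq5 hk; rewrite mu_rec // sum_expr_nonzero ?subr0. Qed.

(** The form [y^2 - xy - x^2] changes sign under the Fibonacci step [(x, y) |-> (y, x + y)]. *)
Lemma mu_norm (F : finFieldType) (k : nat) :
  (forall x : F, x ^+ 2 != 5) -> (0 < k < #|F|)%N ->
  mu F k.+1 ^+ 2 - mu F k.+1 * mu F k - mu F k ^+ 2 = (-1) ^+ k.+1 / 5.
Proof.
move=> nsq5; have n5 := five_neq0 nsq5; have [mu1 mu2] := mu_1_2 nsq5.
case: k => // k; elim: k => [_|k IHk k_lt]; first by rewrite mu1 mu2; field.
have /IHk : (0 < k.+1 < #|F|)%N by lia.
rewrite (@mu_rec0 F k.+1) //; last by lia.
rewrite exprS => /eqP; rewrite -subr_eq0 => /eqP norm_k; rewrite [in RHS]exprS.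
apply/eqP; rewrite -subr_eq0 -[X in _ == X]oppr0 -[in X in _ == X]norm_k.
by apply/eqP; ring.
Qed.

(** The indices [2m] and [2m + 2] add up to [#|F| + 1], so [mu_sym] makes their values opposite; the
    recurrence and [mu_norm] do the rest. *)
Lemma mu_middle (F : finFieldType) (m : nat) :
  (forall x : F, x ^+ 2 != 5) -> #|F| = (4 * m).+1 ->
  (5 * mu F (2 * m)) ^+ 2 = -1 /\ mu F (2 * m).+1 = - 2 * mu F (2 * m).
Proof.
move=> nsq5 cardF; have n5 := five_neq0 nsq5.
have m_gt0 : (0 < m)%N by have := finNzRing_gt1 F; rewrite cardF; lia.
have r : mu F (2 * m).+2 = mu F (2 * m).+1 + mu F (2 * m) by apply: mu_rec0 => //; lia.
have s : mu F (2 * m).+2 = - mu F (2 * m).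
  rewrite (mu_sym (k := (2 * m)%N)) //; last by lia.
  by rewrite !exprS exprM sqrrN !expr1n; ring.
have e : mu F (2 * m).+1 = - 2 * mu F (2 * m).
  by apply: (addIr (mu F (2 * m))); rewrite -r s; ring.
split=> //; have := mu_norm (k := (2 * m)%N) nsq5; rewrite e (exprS (-1)) (exprM (-1)) sqrrN !expr1n.
have -> : (- 2 * mu F (2 * m)) ^+ 2 - - 2 * mu F (2 * m) * mu F (2 * m) - mu F (2 * m) ^+ 2
  = 5 * mu F (2 * m) ^+ 2 by ring.
have k_lt : (0 < 2 * m < #|F|)%N by lia.
by move/(_ k_lt) => norm; rewrite exprMn expr2 -mulrA norm; field.
Qed.

(** If [mu_k = 0], the norm gives [(5 mu_{k+1})^2 = 5] or [-5]; as [-1] is a square, 5 would be one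
    too. *)
Lemma mu_neq0 (F : finFieldType) (m k : nat) :
  (forall x : F, x ^+ 2 != 5) -> #|F| = (4 * m).+1 -> (0 < k < #|F|)%N ->
  mu F k != 0.
Proof.
move=> nsq5 cardF k_lt; have n5 := five_neq0 nsq5.
have [] := mu_middle nsq5 cardF; move: (5 * _) => i sq_i _.
apply/eqP => muk0; have := mu_norm nsq5 k_lt.
rewrite muk0 mulr0 subr0 expr0n subr0 -signr_odd => norm_k.
case: (odd _) norm_k => norm_k.
  move: (nsq5 (5 * i * mu F k.+1)); rewrite !exprMn norm_k sq_i => /eqP; apply.
  by field.
move: (nsq5 (5 * mu F k.+1)); rewrite !exprMn norm_k => /eqP; apply.
by field.
Qed.

(** * Squares, and the pairing of the factors [mu F k] *)

Definition is_square (F : fieldType) (x : F) : Prop := exists y, x = y ^+ 2.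

Lemma is_squareM (F : fieldType) (x y : F) :
  is_square x -> is_square y -> is_square (x * y).
Proof. by move=> [a ->] [b ->]; exists (a * b); rewrite exprMn. Qed.

Lemma is_square_mu_pair (F : finFieldType) (m k l : nat) :
  (forall x : F, x ^+ 2 != 5) -> #|F| = (4 * m).+1 -> (k + l = #|F|.+1)%N ->
  is_square (mu F k * mu F l).
Proof.
move=> nsq5 cardF kl; rewrite (mu_sym nsq5 kl) mulrCA -expr2.
have [sq_i _] := mu_middle nsq5 cardF.
apply: is_squareM; last by exists (mu F k).
by exists ((5 * mu F (2 * m)) ^+ l.+1); rewrite exprAC sq_i.
Qed.

Lemma is_square_prod_mu (F : finFieldType) (m : nat) :
  (forall x : F, x ^+ 2 != 5) -> #|F| = (4 * m).+1 ->
  is_square (\prod_(k < #|F|.-1) mu F k).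
Proof.
move=> nsq5 cardF; have n5 := five_neq0 nsq5.
have m_gt0 : (0 < m)%N by have := finNzRing_gt1 F; rewrite cardF; lia.
have [sq_i mid] := mu_middle nsq5 cardF; have [mu1 _] := mu_1_2 nsq5.
rewrite -(big_mkord xpredT (mu F)).
(* Moving index 0 to [#|F| - 1] makes the range symmetric about [2m + 1], apart from index 1. *)
have -> : \prod_(0 <= k < #|F|.-1) mu F k = \prod_(1 <= k < #|F|) mu F k.
  rewrite big_ltn; last by rewrite cardF; lia.
  rewrite -mu_card_pred mulrC -big_nat_recr /=; last by rewrite cardF; lia.
  by rewrite prednK // cardF; lia.
rewrite big_ltn; last by rewrite cardF; lia.
(* The window of radius [j] about [2m + 1] grows by the indices [2m - j] and [2m + 2 + j], whose sum
   is [#|F| + 1]. *)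
have centered j : (j < 2 * m)%N ->
    is_square (mu F 1 * \prod_((2 * m).+1 - j <= k < (2 * m).+2 + j) mu F k).
  elim: j => [_|j IHj j_lt].
    rewrite subn0 addn0 big_nat1 mid mu1.
    (* This is [(1 - i) / 5] with [i = 5 * mu F (2 * m)]. *)
    exists ((1 - 5 * mu F (2 * m)) / 5).
    have -> : ((1 - 5 * mu F (2 * m)) / 5) ^+ 2 =
      5^-1 ^+ 2 * (1 + (5 * mu F (2 * m)) ^+ 2) - 2 * mu F (2 * m) / 5 * (5 / 5) by ring.
    by rewrite sq_i divff //; ring.
  rewrite addnS big_nat_recr /=; last by lia.
  rewrite big_ltn; last by lia.
  rewrite subSS -subSn ?(ltnW (ltnW j_lt)) //.
  rewrite [_ * _ * mu F _]mulrAC mulrCA.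
  apply: is_squareM; last by apply: IHj; lia.
  by apply: (is_square_mu_pair nsq5 cardF); lia.
have := centered (2 * m).-1; rewrite cardF.
have -> : ((2 * m).+1 - (2 * m).-1 = 2)%N by lia.
have -> : ((2 * m).+2 + (2 * m).-1 = (4 * m).+1)%N by lia.
by apply; lia.
Qed.

(** * Evaluation of the determinant by characters *)

Lemma sum_inj_nonzero (F : finFieldType) (n : nat) (e : 'I_n -> F) (G : F -> F) :
  injective e -> (forall i, e i != 0) -> n.+1 = #|F| ->
  \sum_i G (e i) = \sum_(t | t != 0) G t.
Proof.
move=> e_inj e_neq0 cardF; rewrite -(big_imset _ (in2W e_inj)); apply: eq_bigl => t.
have -> : [set e i | i in 'I_n] = [set~ 0].
  apply/eqP; rewrite eqEcard cardsC1 card_imset // card_ord -cardF leqnn andbT.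
  by apply/subsetP => _ /imsetP[i _ ->]; rewrite !inE.
by rewrite !inE.
Qed.

Lemma det_inv_form (F : finFieldType) (n : nat) (e : 'I_n -> F) :
  injective e -> (forall i, e i != 0) -> n.+1 = #|F| ->
  \det (\matrix_(i, j) (e i ^+ 2 + e i * e j - e j ^+ 2)^-1) =
    (\prod_i (e i)^-1) ^+ 2 * \prod_(k < n) mu F k.
Proof.
move=> e_inj e_neq0 cardF; set M := \matrix_(i, j) _.
pose V := (Vandermonde n (\row_i e i))^T.
have V_neq0 : \det V != 0.
  rewrite det_tr det_Vandermonde; apply/prodf_neq0 => i _; apply/prodf_neq0 => j ij.
  by rewrite !mxE subr_eq0 (inj_eq e_inj); apply: contraTneq ij => ->; rewrite ltnn.
(* Column [k] of [V] lists the [e_i^k]; the substitution [t |-> e_i t] pulls [e_i^(k - 2)] out of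
   row [i] and leaves [mu_k]. *)
have MV : M *m V = diag_mx (\row_i (e i)^-1 ^+ 2) *m V *m diag_mx (\row_k mu F k).
  apply/matrixP => i k; rewrite mul_mx_diag mul_diag_mx !mxE.
  under eq_bigr do rewrite !mxE.
  rewrite (sum_inj_nonzero (fun t => (e i ^+ 2 + e i * t - t ^+ 2)^-1 * t ^+ k)) //.
  rewrite (reindex_inj (mulfI (e_neq0 i))) mulr_sumr.
  apply: eq_big => [t|t _]; first by rewrite mulf_eq0 negb_or e_neq0.
  have -> : e i ^+ 2 + e i * (e i * t) - (e i * t) ^+ 2 = e i ^+ 2 * (1 + t - t ^+ 2) by ring.
  by rewrite invfM exprMn exprVn; ring.
apply: (mulIf V_neq0); rewrite -det_mulmx MV !det_mulmx !det_diag mulrAC.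
congr (_ * _ * _); last by apply: eq_bigr => k _; rewrite mxE.
by rewrite -prodrXl; apply: eq_bigr => i _; rewrite mxE.
Qed.

(** * Inversion as a power, and 5 as a non-square *)

Lemma expf_card_pred2 (F : finFieldType) (x : F) :
  (2 < #|F|)%N -> x ^+ #|F|.-2 = x^-1.
Proof.
move=> F_gt2; have [->|x_neq0] := eqVneq x 0.
  (* The inverse of 0 is 0 by convention, and the exponent is positive since [2 < #|F|]. *)
  by rewrite invr0 expr0n; case: #|F| F_gt2 => [|[|[|]]].
by apply: (mulfI x_neq0); rewrite -exprS divff // prednK ?expf_card_pred //; lia.
Qed.

(* If [x^2 = 5], then [a = (x - 1) / 2] should be [z + 1/z] for a primitive fifth
   root of unity [z], so the companion matrix of ['X^2 - a 'X + 1] has order [5]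
   in [GL_2(F)], whose order is prime to [5]. *)
Lemma five_nonsquare (F : finFieldType) :
  (2 : F) != 0 -> (#|F| %% 5 == 2)%N || (#|F| %% 5 == 3)%N ->
  forall x : F, x ^+ 2 != 5.
Proof.
move=> n2 cardF x; apply/eqP => x2.
pose a := (x - 1) / 2.
have a2 : a ^+ 2 = 1 - a.
  have -> : a ^+ 2 = (x ^+ 2 - 2 * x + 1) / 2 / 2 by rewrite /a; field.
  by rewrite x2 /a; field.
pose A : 'M[F]_2 := \matrix_(i, j) if i == 0 then (j == 1)%:R else if j == 0 then -1 else a.
have A2 : A ^+ 2 = a *: A - 1.
  apply/matrixP => i j; rewrite expr2 !mxE !big_ord_recl big_ord0 !mxE.
  case: i => [[|[|//]] i_lt]; case: j => [[|[|//]] j_lt]; rewrite /= /eq_op /=; ring.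
have A5 : A ^+ 5 = 1.
  pose P : {poly F} := 'X ^+ 2 - a *: 'X + 1.
  have PA : horner_mx A P = 0.
    rewrite rmorphD rmorphB rmorph1 rmorphXn /= linearZ /= horner_mx_X A2.
    by rewrite addrAC subrK subrr.
  (* The fifth cyclotomic polynomial splits into two quadratics because [a] and [-1 - a] are the
     roots of [y^2 + y - 1]. *)
  have X5 : 'X ^+ 5 = P * (('X - 1) * ('X ^+ 2 + (1 + a%:P) * 'X + 1)) + 1.
    have aP : a%:P ^+ 2 = 1 - a%:P :> {poly F} by rewrite -polyC1 -polyCB -a2 rmorphXn.
    rewrite /P -mul_polyC.
    transitivity ((1 - a%:P - a%:P ^+ 2) * 'X ^+ 2 * ('X - 1) + 'X ^+ 5); last by ring.
    by rewrite aP subrr; ring.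
  have := congr1 (horner_mx A) X5.
  by rewrite rmorphXn rmorphD rmorph1 /= horner_mx_X (rmorphM _ P) /= PA mul0r add0r.
have A_unit : A \is a GRing.unit.
  by apply/unitrP; exists (A ^+ 4); rewrite -exprSr -exprS A5.
pose u : {'GL_2[F]} := FinRing.unit _ A_unit.
have u5 : (u ^+ 5 = 1)%g.
  by apply: val_inj; rewrite FinRing.val_unitX.
have u_neq1 : #[u]%g != 1.
  rewrite order_eq1; apply/eqP => /(congr1 val) /= /matrixP/(_ 0 1).
  by rewrite !mxE /= => /eqP; rewrite oner_eq0.
have : (5 %| #|'GL_2[F]%g|)%N.
  have /(prime_nt_dvdP (isT : prime 5) u_neq1) <- : (#[u]%g %| 5)%N by rewrite order_dvdn u5.
  by rewrite order_dvdG ?inE.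
(* With [q = #|F|], the prime factors of the order divide [q], [q - 1] or [q + 1], none of which is
   divisible by 5. *)
rewrite card_GL_2 !Euclid_dvdM //.
lia.
Qed.

(** * Reduction of the integer determinant to ['F_p] *)

Theorem corollary2p1 (p : nat) (p_prime : prime p)
    (p_mod4 : (p = 1 %[mod 4])%N)
    (p_mod5 : (p = 2 %[mod 5])%Z \/ (p = - 2 %[mod 5])%Z) :
  legendre (D p 1 (-1)) p = 1.
Proof.
have p_gt1 := prime_gt1 p_prime.
have cardF := card_Fp p_prime.
pose m := (p %/ 4)%N.
have p_eq : p = (4 * m).+1 by rewrite {1}(divn_eq p 4) p_mod4 mulnC addn1.
have natr_neq0 k : (0 < k < p)%N -> (k%:R : 'F_p) != 0.
  case/andP=> k_gt0 k_lt; rewrite -(dvdn_pcharf (pchar_Fp p_prime)).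
  by rewrite gtnNdvd.
have nsq5 : forall x : 'F_p, x ^+ 2 != 5.
  apply: five_nonsquare; first by apply: natr_neq0; lia.
  rewrite cardF; lia.
pose e (i : 'I_p.-1) : 'F_p := (i.+1)%:R.
have e_neq0 i : e i != 0 by apply: natr_neq0; have := ltn_ord i; lia.
have e_inj : injective e.
  have val_e i : (e i : nat) = i.+1.
    by rewrite val_Fp_nat // modn_small //; have := ltn_ord i; lia.
  move=> i j /(congr1 (@nat_of_ord _)); rewrite !val_e => -[]; exact: val_inj.
have n_card : p.-1.+1 = #|'F_p| by rewrite cardF; lia.
have detE : (D p 1 (-1))%:~R = (\prod_i (e i)^-1) ^+ 2 * \prod_(k < p.-1) mu 'F_p k.
  rewrite -(det_inv_form e_inj) // -det_map_mx; congr (\det _).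
  apply/matrixP => i j; rewrite !mxE rmorphXn /= !rmorphD /= !rmorphM /= rmorphN1 mul1r mulN1r.
  set x := _ + _ - _; have -> : (p - 2 = #|'F_p|.-2)%N by rewrite cardF subn2.
  by rewrite expf_card_pred2 ?cardF; [|lia].
have cardF4 : #|'F_p| = (4 * m).+1 by rewrite cardF.
have D_neq0 : ((D p 1 (-1))%:~R : 'F_p) != 0.
  rewrite detE mulf_neq0 //.
    by apply/expf_neq0/prodf_neq0 => i _; rewrite invr_eq0.
  apply/prodf_neq0 => k _.
  (* [mu_neq0] starts at index 1, so index 0 is read as [p - 1]. *)
  case: k => [[|k] /= k_lt].
    by rewrite -mu_card_pred (mu_neq0 nsq5 cardF4) // cardF; lia.
  by rewrite (mu_neq0 nsq5 cardF4) // cardF; lia.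
have [y yE] : is_square ((D p 1 (-1))%:~R : 'F_p).
  rewrite detE; apply: is_squareM; first by eexists.
  by have := is_square_prod_mu nsq5 cardF4; rewrite -n_card.
rewrite /legendre (dvdz_pcharf (pchar_Fp p_prime)) (negPf D_neq0).
case: ifP => // /existsP[].
(* The bound of the ordinal type ['F_p] equals [p] only through [Fp_cast], so the root is rebuilt in
   ['I_p]. *)
have y_lt : (val y < p)%N by have := ltn_ord y; rewrite [leqRHS]Fp_cast.
exists (Ordinal y_lt); rewrite eqz_mod_dvd (dvdz_pcharf (pchar_Fp p_prime)).
rewrite rmorphB rmorphXn /= yE.
by rewrite -pmulrn natr_Zp subrr.
Qed.
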